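(* Let $n\geq 3$, $j\in\{2,\dots,n-1\}$, $p\in[0,1)$ and $\lambda\in(0,1)$. Then there exist origin-symmetric convex bodies $K$ and $L$ in $\mathbb R^n$ such that $$V_j\big((1-\lambda)\cdot K+_p\lambda\cdot L\big)<V_j(K)^{1-\lambda}V_j(L)^{\lambda}\leq \Big((1-\lambda)V_j(K)^{p/j}+\lambda V_j(L)^{p/j}\Big)^{j/p},$$ where for $p=0$ the right-most expression is understood as $V_j(K)^{1-\lambda}V_j(L)^\lambda$.
   Context: A convex body is a compact convex subset of $\mathbb R^n$ with nonempty interior; it is (origin-)symmetric if $K=-K$. The support function is $h_K(x)=\max_{y\in K}\langle x,y\rangle$. For a continuous $f:\mathbb S^{n-1}\to(0,\infty)$, its Wulff shape $W(f)$ is the largest convex body whose support function is $\le f$ on $\mathbb S^{n-1}$. For convex bodies $K,L$ containing the origin in their interior, $\lambda\in(0,1)$, the $L_p$-Minkowski combination is $(1-\lambda)\cdot K+_p\lambda\cdot L:=W\big(((1-\lambda)h_K^p+\lambda h_L^p)^{1/p}\big)$ for $p\neq 0$ and $W(h_K^{1-\lambda}h_L^\lambda)$ for $p=0$. The intrinsic volumes $V_0(K),\dots,V_n(K)$ are defined by the Steiner formula $V_n(K+\rho B_2^n)=\sum_{j=0}^n\rho^{n-j}\kappa_{n-j}V_j(K)$ for $\rho>0$, where $V_n$ is volume, $B_2^n$ the Euclidean unit ball and $\kappa_d$ the volume of the $d$-dimensional unit ball. *)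

(* Defs.v *)
From HB Require Import structures.
From mathcomp Require Import all_boot all_order all_algebra.
From mathcomp Require Import all_classical all_reals all_analysis.
From Stdlib Require Import ClassicalEpsilon.
Set Implicit Arguments. Unset Strict Implicit. Unset Printing Implicit Defensive.
Import Order.TTheory GRing.Theory Num.Theory.
Import numFieldNormedType.Exports.
Local Open Scope classical_set_scope.
Local Open Scope ring_scope.

Section ConvexGeometry.
Variable R : realType.

Definition dotv (n : nat) (x y : 'rV[R]_n) : R := \sum_(i < n) x 0 i * y 0 i.

Definition unit_ball (n : nat) : set 'rV[R]_n := [set x | dotv x x <= 1].
Definition unit_sphere (n : nat) : set 'rV[R]_n := [set u | dotv u u = 1].

(* n-dimensional Lebesgue measure, defined as an iterated Lebesgue integral
   (Tonelli): vol_0 A = 1 iff the unique point of R^0 is in A,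
   vol_{m+1} A = \int_R vol_m (section of A at first coordinate t) dt. *)
Fixpoint volume (n : nat) : set 'rV[R]_n -> \bar R :=
  match n return set 'rV[R]_n -> \bar R with
  | 0 => fun A => if `[< A 0 >] then 1%E else 0%E
  | m.+1 => fun A =>
      (\int[@lebesgue_measure R]_(t in [set: R])
          volume [set y : 'rV[R]_m | A (row_mx (\row_(k < 1) t) y)])%E
  end.

Definition kappa (d : nat) : R := fine (volume (@unit_ball d)).

Definition convex_set (n : nat) (K : set 'rV[R]_n) : Prop :=
  forall x y t, K x -> K y -> 0 <= t <= 1 -> K (t *: x + (1 - t) *: y).

Definition convex_body (n : nat) (K : set 'rV[R]_n) : Prop :=
  convex_set K /\ compact K /\ (interior K !=set0).

Definition origin_symmetric (n : nat) (K : set 'rV[R]_n) : Prop :=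
  forall x, K x -> K (- x).

Definition support_fun (n : nat) (K : set 'rV[R]_n) (x : 'rV[R]_n) : R :=
  sup [set dotv x y | y in K].

(* Wulff shape (Alexandrov body) of f : S^{n-1} -> (0,oo): the largest
   convex body whose support function is <= f on S^{n-1}, i.e.
   W(f) = {x | <x,u> <= f(u) for all u in S^{n-1}}. *)
Definition wulff (n : nat) (f : 'rV[R]_n -> R) : set 'rV[R]_n :=
  [set x | forall u, @unit_sphere n u -> dotv x u <= f u].

Definition Lp_comb (n : nat) (p lam : R) (K L : set 'rV[R]_n) : set 'rV[R]_n :=
  if p == 0 then
    wulff (fun u => (support_fun K u `^ (1 - lam)) * (support_fun L u `^ lam))
  else
    wulff (fun u => ((1 - lam) * support_fun K u `^ p
                     + lam * support_fun L u `^ p) `^ (p^-1)).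

Definition parallel_body (n : nat) (K : set 'rV[R]_n) (rho : R) : set 'rV[R]_n :=
  [set z | exists x b, K x /\ @unit_ball n b /\ z = x + rho *: b].

Definition steiner_coeffs (n : nat) (K : set 'rV[R]_n) (V : nat -> R) : Prop :=
  forall rho : R, 0 < rho ->
    volume (parallel_body K rho) =
      (\sum_(j < n.+1) rho ^+ (n - j) * kappa (n - j) * V j)%:E.

(* intrinsic volumes V_0(K), ..., V_n(K): the (unique) coefficients in the
   Steiner formula *)
Definition intrinsic_volume (n : nat) (K : set 'rV[R]_n) (j : nat) : R :=
  epsilon (inhabits (fun _ : nat => 0)) (steiner_coeffs K) j.

End ConvexGeometry.

(* Main.v *)
(* Both bodies are axis-parallel boxes.  The mean defining the [L_p] combination
   is homogeneous and superadditive for [p <= 1], so the combination of two boxes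
   is the box whose widths are the [p]-means of the widths.  Slicing shows that a
   box satisfies the Steiner formula with [V_j] the [j]-th elementary symmetric
   function of its widths.  Take [j - 1] widths equal to [1], the next two equal to
   [d] and [d r] for [K], to [d r] and [d] for [L], and all others equal to [d^2].
   Then [V_j K] and [V_j L] are at least [d], while [V_j] of the combination is
   [d (M(1, r) + M(r, 1)) + O(d^2)], where [M] is the [p]-mean; since [p < 1], the
   factor of [d] is below [1] once [r] is small. *)
Require Import Defs.
From HB Require Import structures.
From mathcomp Require Import all_boot all_order all_algebra.
From mathcomp Require Import all_classical all_reals all_analysis.
From mathcomp Require Import measurable_realfun ring lra zify.
Import Order.TTheory GRing.Theory Num.Theory.
Import numFieldNormedType.Exports.
Local Open Scope classical_set_scope.
Local Open Scope ring_scope.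
Set Implicit Arguments.
Unset Strict Implicit.

(** * Affine changes of variable and integration against the distance to an interval *)

Section ChangeOfVariables.
Context {R : realType}.
Local Notation mu := (@lebesgue_measure R).

Lemma preimage_affine_itvoc (c e a b : R) : 0 < c ->
  (fun t => c * t + e) @^-1` `]a, b] = `](a - e) / c, (b - e) / c]%classic.
Proof.
move=> c0; apply/seteqP; split => t /=; rewrite !in_itv/= ltr_pdivrMr// ler_pdivlMr//;
by rewrite ltrBlDr lerBrDr (mulrC t).
Qed.

(** Lebesgue measure is [c] times its pushforward under [t |-> c * t + e]: by uniqueness it is
    enough to compare the two on half-open intervals. *)
Lemma ge0_integral_affine (c e : R) (f : R -> \bar R) : 0 < c ->
  measurable_fun [set: R] f -> (forall t, (0 <= f t)%E) ->
  (\int[mu]_t f t = c%:E * \int[mu]_t f (c * t + e)%R)%E.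
Proof.
move=> c0 mf f0.
pose phi : measurableTypeR R -> measurableTypeR R := fun t => c * t + e.
have mphi : measurable_fun [set: measurableTypeR R] phi.
  by apply: measurable_funD => //; apply: measurable_funM.
pose push : {measure set (measurableTypeR R) -> \bar R} :=
  measure_function_pushforward__canonical__measure_function_Measure mu mphi.
pose nu := mscale (NngNum (ltW c0)) push.
have munu A : measurable A -> mu A = nu A.
  apply: lebesgue_measure_unique => _ [[a b]] _ <-.
  transitivity (c%:E * mu `]((a - e) / c)%R, ((b - e) / c)%R])%E; last first.
    by rewrite -preimage_affine_itvoc.
  rewrite !lebesgue_measure_itv/= !lte_fin ltr_pM2r ?invr_gt0// ltrD2r.
  case: ifPn => _; last by rewrite mule0.
  by rewrite -EFinD -EFinM; congr EFin; field; rewrite gt_eqF.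
transitivity (\int[nu]_t f t)%E.
  by apply: eq_measure_integral => A mA _; exact: munu.
rewrite ge0_integral_mscale//; congr (_ * _)%E.
by rewrite ge0_integral_pushforward.
Qed.

Lemma ge0_integral_shift (e : R) (f : R -> \bar R) :
  measurable_fun [set: R] f -> (forall t, (0 <= f t)%E) ->
  (\int[mu]_t f (t + e)%R = \int[mu]_t f t)%E.
Proof.
move=> mf f0; rewrite [RHS](@ge0_integral_affine 1 e)// mul1e.
by under [RHS]eq_integral do rewrite mul1r.
Qed.

Lemma ge0_integral_split3 (x y : R) (f : R -> \bar R) : x <= y ->
  measurable_fun [set: R] f -> (forall t, (0 <= f t)%E) ->
  (\int[mu]_t f t = \int[mu]_(t in `]-oo, x[) f t +
    \int[mu]_(t in `[x, y]) f t + \int[mu]_(t in `]y, +oo[) f t)%E.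
Proof.
move=> xy mf f0.
have mf' (D : set R) : measurable_fun D f by exact: measurable_funS mf.
have e1 : [set: R] = (`]-oo, x[ `|` `[x, y]) `|` `]y, +oo[.
  apply/esym/seteqP; split => // t _ /=; rewrite !in_itv/= !andbT.
  have [tx|xt] := ltP t x; first by left; left.
  by have [ty|yt] := leP t y; [left; right | right].
have m12 : measurable (`]-oo, x[ `|` `[x, y])%classic by exact: measurableU.
rewrite e1 ge0_integral_setU//; [|exact: mf'|]; last first.
  apply/disj_setPS => t /= -[]; rewrite !in_itv/= andbT => -[tx|/andP[_ ty]] yt.
    by have := lt_trans (le_lt_trans xy yt) tx; rewrite ltxx.
  by have := lt_le_trans yt ty; rewrite ltxx.
rewrite ge0_integral_setU//; first exact: mf'.
apply/disj_setPS => t /= -[]; rewrite !in_itv/= => tx /andP[xt _].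
by have := lt_le_trans tx xt; rewrite ltxx.
Qed.

Lemma ge0_integral_shift_in (D D' : set R) (e : R) (f : R -> \bar R) :
  (forall t, D' t <-> D (t + e)) ->
  measurable D -> measurable_fun [set: R] f -> (forall t, (0 <= f t)%E) ->
  (\int[mu]_(t in D') f (t + e)%R = \int[mu]_(t in D) f t)%E.
Proof.
move=> DD' mD mf f0; rewrite integral_mkcond [RHS]integral_mkcond.
rewrite -(@ge0_integral_shift e (f \_ D)).
- apply: eq_integral => t _; rewrite /patch.
  have -> // : (t \in D') = ((t + e) \in D).
  by apply/idP/idP; rewrite !inE => /DD'.
- by apply/(measurable_restrictT _ mD); exact: measurable_funS mf.
- by move=> t; rewrite /patch; case: ifP.
Qed.

(** For [0 <= a], the distance from [t] to the interval [[-a, a]]. *)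
Definition gap (a t : R) : R := Num.max 0 (`|t| - a).

Lemma gap0 (t : R) : gap 0 t = `|t|.
Proof. by rewrite /gap subr0 max_r. Qed.

Lemma measurable_gap (a : R) : measurable_fun [set: R] (gap a).
Proof.
apply: measurable_maxr => //; apply: measurable_funB => //.
Qed.

(** On [[-a, a]] the integrand is constantly [g 0]; the two outer half-lines are translated by [a]
    until they meet at the origin. This is the one-dimensional source of the factor [1 + 2 a X] in
    the Steiner polynomial. *)
Lemma ge0_integral_gap (a : R) (g : R -> \bar R) : 0 <= a ->
  measurable_fun [set: R] g -> (forall t, (0 <= g t)%E) ->
  (\int[mu]_t g (gap a t) = (2 * a)%:E * g 0%R + \int[mu]_t g `|t|%R)%E.
Proof.
move=> a0 mg g0; pose h (t : R) := g `|t|.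
have mh : measurable_fun [set: R] h.
  by apply: measurableT_comp => //.
have h0 t : (0 <= h t)%E by exact: g0.
rewrite (@ge0_integral_split3 (- a) a); [|lra| |by []]; last first.
  by apply: measurableT_comp => //; exact: measurable_gap.
(* The right-hand integral is split at the degenerate interval [{0}], so that its half-lines can be
   matched with those on the left; the point itself contributes nothing. *)
rewrite [in RHS](@ge0_integral_split3 0 0 h)//.
have -> : (\int[mu]_(t in `]-oo, (- a)%R[) g (gap a t) =
  \int[mu]_(t in `]-oo, 0%R[) h t)%E.
  rewrite -[RHS](@ge0_integral_shift_in _ `]-oo, (- a)%R[%classic a)//; last first.
    by move=> t /=; rewrite !in_itv/=; split => ?; lra.
  apply: eq_integral => t; rewrite inE/= in_itv/= => ta.
  rewrite /h /gap ltr0_norm; last lra.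
  by rewrite ltr0_norm ?max_r; [congr g; lra|lra|lra].
have -> : (\int[mu]_(t in `]a, +oo[) g (gap a t) =
  \int[mu]_(t in `]0%R, +oo[) h t)%E.
  rewrite -[RHS](@ge0_integral_shift_in _ `]a, +oo[%classic (- a))//; last first.
    by move=> t /=; rewrite !in_itv/= !andbT; split => ?; lra.
  apply: eq_integral => t; rewrite inE/= in_itv/= andbT => ta.
  rewrite /h /gap gtr0_norm; last lra.
  by rewrite gtr0_norm ?max_r//; lra.
have -> : (\int[mu]_(t in `[(- a)%R, a]) g (gap a t) = (2 * a)%:E * g 0%R)%E.
  transitivity (\int[mu]_(t in `[(- a)%R, a]) (cst (g 0%R)) t)%E.
    apply: eq_integral => t; rewrite inE/= in_itv/= -ler_norml => ta.
    by rewrite /gap max_l//; lra.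
  rewrite integral_cst//= lebesgue_measure_itv/= lte_fin muleC.
  congr (_ * _)%E; case: ifPn => aa.
    by rewrite opprK -EFinD; congr EFin; lra.
  by congr EFin; lra.
rewrite set_itv1 integral_set1 adde0.
by rewrite [X in (X + _)%E]addeC -addeA.
Qed.

End ChangeOfVariables.

(** * Volumes of neighbourhoods of boxes, by slicing *)

Section ParallelBodyOfBox.
Context {R : realType}.
Local Notation mu := (@lebesgue_measure R).

(** The [d]-th power of a radius, as a function of the squared radius [s]. The test matters for
    [d = 0]: without it a negative [s], that is an empty slice, would give [1]. *)
Definition radius_pow (d : nat) (s : R) : R :=
  if s < 0 then 0 else Num.sqrt s ^+ d.

Lemma radius_pow_ge0 d s : 0 <= radius_pow d s.
Proof. by rewrite /radius_pow; case: ifP => // _; rewrite exprn_ge0// sqrtr_ge0. Qed.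

Lemma radius_pow_sqr d (r : R) : 0 <= r -> radius_pow d (r ^+ 2) = r ^+ d.
Proof. by move=> r0; rewrite /radius_pow ltNge sqr_ge0 /= sqrtr_sqr ger0_norm. Qed.

Lemma radius_pow_scale d (c s : R) : 0 < c ->
  radius_pow d (c ^+ 2 * s) = c ^+ d * radius_pow d s.
Proof.
move=> c0; rewrite /radius_pow pmulr_rlt0 ?exprn_gt0//.
case: ifPn => _; first by rewrite mulr0.
by rewrite sqrtrM ?sqr_ge0// sqrtr_sqr gtr0_norm// exprMn.
Qed.

Lemma measurable_radius_pow d : measurable_fun [set: R] (radius_pow d).
Proof.
apply: measurable_fun_ifT => //.
  by apply: measurable_fun_ltr.
apply: measurable_funX.
apply: continuous_measurable_fun; exact: sqrt_continuous.
Qed.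

Lemma measurable_radius_pow_slice d (s : R) :
  measurable_fun [set: R] (fun t : R => radius_pow d (s - t ^+ 2)).
Proof.
apply: (measurableT_comp (measurable_radius_pow d)).
by apply: measurable_funB => //; apply: measurable_funX.
Qed.

(** The ratio between the volumes of the unit balls in dimensions [d + 1] and [d]. *)
Definition slice_integral (d : nat) : \bar R :=
  (\int[mu]_t (radius_pow d (1 - t ^+ 2))%:E)%E.

Lemma slice_integral_lty d : (slice_integral d < +oo)%E.
Proof.
apply: (@le_lt_trans _ _ (\int[mu]_t (\1_(`[(-1)%R, 1%R]%classic) t)%:E)%E).
  apply: ge0_le_integral => //.
  - by move=> t _; rewrite lee_fin radius_pow_ge0.
  - by apply/measurable_EFinP; exact: measurable_radius_pow_slice.
  - by apply/measurable_EFinP; exact: measurable_indic.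
  - move=> t _; rewrite lee_fin /radius_pow; case: ifPn => [_|].
      by rewrite indicE; case: (_ \in _).
    rewrite -leNgt => t1; rewrite indicE mem_set /=.
      rewrite exprn_ile1 ?sqrtr_ge0// -[leRHS]sqrtr1 ler_sqrt// gerBl sqr_ge0//.
    rewrite in_itv/= -ler_norml -[leRHS]sqrtr1 -sqrtr_sqr ler_sqrt//.
    by rewrite -subr_ge0.
rewrite integral_indic//= setIT lebesgue_measure_itv/= lte_fin.
by case: ifP => _; rewrite ?ltry// -EFinD ltry.
Qed.

Lemma slice_integral_gt0 d : (0 < slice_integral d)%E.
Proof.
(* On [[0, 1/2]] one has [1 - t ^+ 2 >= 1/4], so the radius of the slice is at least [1/2]. *)
apply: (@lt_le_trans _ _ (\int[mu]_(t in `[0%R, (2^-1)%R]) (cst ((2^-1 ^+ d)%:E)) t)%E).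
  rewrite integral_cst//= lebesgue_measure_itv/= lte_fin invr_gt0 ltr0n.
  by rewrite -EFinD -EFinM lte_fin subr0 mulr_gt0// exprn_gt0// invr_gt0.
apply: (@le_trans _ _ (\int[mu]_(t in `[0%R, (2^-1)%R])
    (radius_pow d (1 - t ^+ 2))%:E)%E).
  apply: ge0_le_integral => //.
  - by move=> t _; rewrite lee_fin exprn_ge0// invr_ge0.
  - apply/measurable_EFinP; apply: measurable_funS (measurable_radius_pow_slice d 1) => //.
  - move=> t /=; rewrite in_itv/= => /andP[t0 t1]; rewrite lee_fin /radius_pow.
    have t2 : t ^+ 2 <= 2^-1 * 2^-1 by rewrite expr2 ler_pM.
    rewrite ltNge (_ : 0 <= 1 - t ^+ 2)/=; last lra.
    rewrite lerXn2r ?nnegrE ?sqrtr_ge0 ?invr_ge0//.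
    rewrite -[leLHS]ger0_norm ?invr_ge0// -sqrtr_sqr ler_sqrt; last lra.
    by rewrite expr2; lra.
apply: ge0_subset_integral => //.
- by apply/measurable_EFinP; exact: measurable_radius_pow_slice.
- by move=> t _; rewrite lee_fin radius_pow_ge0.
Qed.

(** For [s > 0], substituting [t = c * t'] with [c] the square root of [s] pulls out [c ^+ d] from
    the integrand and one more [c] from the measure. *)
Lemma integral_radius_pow d (s : R) :
  (\int[mu]_t (radius_pow d (s - t ^+ 2))%:E =
   (fine (slice_integral d) * radius_pow d.+1 s)%:E)%E.
Proof.
have [s0|s0|->] := ltgtP s 0.
- rewrite /radius_pow s0 mulr0; apply: integral0_eq => t _.
  by rewrite (_ : s - t ^+ 2 < 0)//; have := sqr_ge0 t; lra.
- pose c := Num.sqrt s.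
  have c0 : 0 < c by rewrite sqrtr_gt0.
  have cs : s = c ^+ 2 by rewrite sqr_sqrtr// ltW.
  rewrite (@ge0_integral_affine _ c 0)//; last 2 first.
  - by apply/measurable_EFinP; exact: measurable_radius_pow_slice.
  - by move=> t; rewrite lee_fin radius_pow_ge0.
  rewrite (@eq_integral _ _ _ mu _ (fun t => (c ^+ d)%:E * (radius_pow d (1 - t ^+ 2))%:E)%E);
    last first.
    move=> t _; rewrite addr0 exprMn cs -[X in X - _]mulr1 -mulrBr.
    by rewrite radius_pow_scale.
  rewrite ge0_integralZl_EFin ?exprn_ge0 ?ltW//; last 2 first.
  - by move=> t _; rewrite lee_fin radius_pow_ge0.
  - by apply/measurable_EFinP; exact: measurable_radius_pow_slice.
  rewrite -/(slice_integral d) -(@fineK _ (slice_integral d)); last first.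
    by rewrite ge0_fin_numE ?slice_integral_lty// ltW// slice_integral_gt0.
  by rewrite /= cs radius_pow_sqr ?ltW// -!EFinM mulrA -exprS mulrC.
- rewrite [in RHS]/radius_pow ltxx sqrtr0 expr0n/= mulr0.
  (* At [s = 0] the integrand is supported on the null set [{0}]; for [d = 0] its value there is
     [1], so it is not identically zero. *)
  transitivity (\int[mu]_(t in [set 0%R]) (radius_pow d (0 - t ^+ 2))%:E)%E.
    rewrite [RHS]integral_mkcond; apply: eq_integral => t _.
    rewrite /patch; case: ifPn => //; rewrite notin_setE /= => /eqP t0.
    by rewrite /radius_pow sub0r oppr_lt0 exprn_even_gt0// t0.
  by rewrite integral_set1.
Qed.

(** The volume of the unit ball, in the recursive form that slicing produces; [kappaE] identifies it
    with [kappa]. *)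
Fixpoint ball_const (d : nat) : R :=
  if d is d'.+1 then ball_const d' * fine (slice_integral d') else 1.

Lemma ball_const_gt0 d : 0 < ball_const d.
Proof.
elim: d => //= d IHd; rewrite mulr_gt0// fine_gt0// slice_integral_gt0.
exact: slice_integral_lty.
Qed.

(* The [j]-th coefficient is the [j]-th elementary symmetric function of the
   widths [w 0, ..., w (n - 1)]. *)
Definition box_poly (n : nat) (w : nat -> R) : {poly R} :=
  \prod_(i < n) (1 + w i *: 'X).

Lemma box_polyS n w :
  box_poly n.+1 w = (1 + w 0%N *: 'X) * box_poly n (fun i => w i.+1).
Proof. by rewrite /box_poly big_ord_recl. Qed.

Lemma coef_box_polyS n w j : (box_poly n.+1 w)`_j =
  (box_poly n (fun i => w i.+1))`_j +
  (if j is j'.+1 then w 0%N * (box_poly n (fun i => w i.+1))`_j' else 0).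
Proof.
rewrite box_polyS mulrDl mul1r coefD -scalerAl coefZ coefXM.
by case: j => //=; rewrite mulr0.
Qed.

Lemma coef_box_poly_ge0 n w j : (forall i, 0 <= w i) -> 0 <= (box_poly n w)`_j.
Proof.
elim: n w j => [|n IHn] w j w0; first by rewrite /box_poly big_ord0 coef1 ler0n.
rewrite coef_box_polyS addr_ge0 ?IHn//.
by case: j => // j; rewrite mulr_ge0// IHn.
Qed.

Lemma coef_box_poly_gt n w j : (n < j)%N -> (box_poly n w)`_j = 0.
Proof.
elim: n w j => [|n IHn] w j nj.
  by rewrite /box_poly big_ord0 coef1; case: j nj.
rewrite coef_box_polyS IHn; last exact: ltn_trans nj.
by case: j nj => // j nj; rewrite IHn// mulr0 addr0.
Qed.

(** The points at squared distance at most [s] from the box with half-widths [a]. With the squared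
    distance as parameter, and [s] allowed to be negative, every hyperplane section is again a set
    of this family. *)
Definition box_nbhd (n : nat) (a : nat -> R) (s : R) : set 'rV[R]_n :=
  [set z | \sum_(i < n) gap (a i) (z 0 i) ^+ 2 <= s].

Lemma row_mx_cons0 n t (y : 'rV[R]_n) :
  row_mx (\row_(k < 1) t) y 0 (@ord0 n : 'I_(1 + n)) = t.
Proof. by rewrite mxE; case: splitP => // k _; rewrite mxE. Qed.

Lemma row_mx_consS n t (y : 'rV[R]_n) (i : 'I_n) :
  row_mx (\row_(k < 1) t) y 0 (lift ord0 i : 'I_(1 + n)) = y 0 i.
Proof.
rewrite mxE; case: splitP => [[[]]//|k /= /eqP].
by rewrite /bump /= eqSS => /eqP/val_inj ->.
Qed.

Lemma box_nbhd_section n a s t :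
  [set y : 'rV[R]_n | @box_nbhd n.+1 a s (row_mx (\row_(k < 1) t) y)] =
  @box_nbhd n (fun i => a i.+1) (s - gap (a 0%N) t ^+ 2).
Proof.
have sumE (y : 'rV[R]_n) :
    \sum_(i < n.+1) gap (a i) (row_mx (\row_(k < 1) t) y 0 (i : 'I_(1 + n))) ^+ 2
    = gap (a 0%N) t ^+ 2 + \sum_(i < n) gap (a i.+1) (y 0 i) ^+ 2.
  rewrite big_ord_recl; congr (gap _ _ ^+ 2 + _); first exact: row_mx_cons0.
  by apply: eq_bigr => i _; congr (gap _ _ ^+ 2); exact: row_mx_consS.
by apply/seteqP; split => y; rewrite /box_nbhd/= sumE lerBrDl.
Qed.

(** Induction by slicing along the first coordinate. The slices through the box itself multiply the
    lower-dimensional volume by [2 * a 0], while those beyond it raise the dimension of each ball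
    factor by one; these are the two terms of [coef_box_polyS]. *)
Lemma volume_box_nbhd n a s : (forall i, 0 <= a i) ->
  volume (@box_nbhd n a s) =
  (\sum_(j < n.+1) (box_poly n (fun i => 2 * a i))`_j *
     (ball_const (n - j) * radius_pow (n - j) s))%:E.
Proof.
elim: n a s => [|n IHn] a s a0.
  rewrite big_ord1 /box_poly big_ord0 coef1 /= !mul1r /radius_pow expr0.
  case: asboolP; rewrite /box_nbhd/= big_ord0 ltNge; first by move=> ->.
  by move/negP/negbTE => ->.
pose c j := (box_poly n (fun i => 2 * a i.+1))`_j.
have c0 j : 0 <= c j by apply: coef_box_poly_ge0 => i; rewrite mulr_ge0.
(* [G u] is the volume of the slice whose first coordinate lies at distance [u] from its
   interval. *)
pose G (u : R) : \bar R := (\sum_(j < n.+1) (c j * ball_const (n - j))%:E *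
  (radius_pow (n - j) (s - u ^+ 2))%:E)%E.
have G0 u : (0 <= G u)%E.
  by apply: sume_ge0 => j _; rewrite mule_ge0// lee_fin ?radius_pow_ge0// mulr_ge0// ltW// ball_const_gt0.
have mG : measurable_fun [set: R] G.
  apply: emeasurable_sum => j; apply: emeasurable_funM => //.
  by apply/measurable_EFinP; exact: measurable_radius_pow_slice.
transitivity (\int[mu]_t G (gap (a 0%N) t))%E.
  transitivity (\int[mu]_t volume [set y : 'rV[R]_n |
    @box_nbhd n.+1 a s (row_mx (\row_(k < 1) t) y)])%E; first by [].
  apply: eq_integral => t _; rewrite box_nbhd_section IHn//.
  by rewrite /G -sumEFin; apply: eq_bigr => j _; rewrite mulrA EFinM.
rewrite ge0_integral_gap//.
have -> : (\int[mu]_t G `|t|%R = (\sum_(j < n.+1) c j *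
    (ball_const (n.+1 - j) * radius_pow (n.+1 - j) s))%:E)%E.
  rewrite ge0_integral_sum//; last 2 first.
  - move=> j; apply: emeasurable_funM => //.
    apply/measurable_EFinP; under eq_fun do rewrite real_normK ?num_real//.
    exact: measurable_radius_pow_slice.
  - by move=> j t _; rewrite mule_ge0// lee_fin ?radius_pow_ge0// mulr_ge0// ltW// ball_const_gt0.
  rewrite -sumEFin; apply: eq_bigr => j _.
  rewrite (@eq_integral _ _ _ mu _ (fun t => (c j * ball_const (n - j))%:E *
    (radius_pow (n - j) (s - t ^+ 2))%:E)%E); last first.
    by move=> t _; rewrite real_normK ?num_real.
  rewrite ge0_integralZl_EFin//; last 3 first.
  - by move=> t _; rewrite lee_fin radius_pow_ge0.
  - by apply/measurable_EFinP; exact: measurable_radius_pow_slice.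
  - by rewrite mulr_ge0// ltW// ball_const_gt0.
  rewrite integral_radius_pow -EFinM subSn -1?ltnS//=; congr EFin; ring.
rewrite /G expr0n/= subr0; under eq_bigr do rewrite -EFinM.
rewrite sumEFin -EFinM -EFinD; congr EFin.
(* The two partial sums have lengths differing by one from the target: the coefficient of index
   [n + 1] vanishes in one, the term of index [0] in the other. *)
under [RHS]eq_bigr do rewrite coef_box_polyS mulrDl.
rewrite [RHS]big_split/= addrC; congr (_ + _); last first.
  by rewrite [RHS]big_ord_recr/= (@coef_box_poly_gt n _ n.+1)// mul0r addr0.
rewrite [RHS]big_ord_recl/= mul0r add0r mulr_sumr.
by apply: eq_bigr => j _; rewrite /= /c subSS !mulrA.
Qed.

End ParallelBodyOfBox.

(** * Boxes as convex bodies: intrinsic volumes and support functions *)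

Section BoxBodies.
Context {R : realType}.

(** The unit ball is the neighbourhood of a box with all widths zero, for which only the coefficient
    of index [0] survives. *)
Lemma kappaE d : kappa R d = ball_const d.
Proof.
rewrite /kappa (_ : @unit_ball R d = @box_nbhd R d (fun=> 0) 1); last first.
  have sumE (x : 'rV[R]_d) : dotv x x = \sum_(i < d) gap 0 (x 0 i) ^+ 2.
    by apply: eq_bigr => i _; rewrite gap0 real_normK ?num_real// expr2.
  by apply/seteqP; split => x; rewrite /unit_ball /box_nbhd /= sumE.
rewrite volume_box_nbhd//= big_ord_recl/= subn0.
rewrite (_ : box_poly d _ = 1); last first.
  by rewrite /box_poly big1// => i _; rewrite mulr0 scale0r addr0.
rewrite coef1 mul1r big1 ?addr0; last by move=> i _; rewrite coef1 mul0r.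
by rewrite -(expr1n _ 2) radius_pow_sqr// expr1n mulr1.
Qed.

(** The difference of the two Steiner polynomials vanishes at every positive number, hence is zero,
    and the ball volumes multiplying [V] and [W] are nonzero. The bound [j <= n] is essential, as
    the Steiner formula says nothing about later indices. *)
Lemma steiner_coeffs_unique n (K : set 'rV[R]_n) (V W : nat -> R) j :
  (j <= n)%N -> steiner_coeffs K V -> steiner_coeffs K W -> V j = W j.
Proof.
move=> jn hV hW.
pose P := \poly_(k < n.+1) (ball_const k * (V (n - k)%N - W (n - k)%N)).
have P0 (r : R) : 0 < r -> P.[r] = 0.
  move=> r0; have := hV r r0; rewrite hW// => -[] /eqP.
  rewrite -subr_eq0 -sumrB => /eqP h.
  rewrite horner_poly (reindex_inj rev_ord_inj)/= -[RHS]oppr0 -[in RHS]h -sumrN.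
  apply: eq_bigr => i _; rewrite subSS kappaE subKn -1?ltnS//; ring.
have {}P0 : P = 0.
  apply/eqP/contraT => Pn0.
  (* The roots [1, ..., n + 1] are already too many for degree at most [n]. *)
  pose rs := [seq k.+1%:R : R | k <- iota 0 n.+1].
  have := @max_poly_roots _ P rs Pn0.
  rewrite (_ : all _ _); last first.
    by apply/allP => _ /mapP[k _ ->]; rewrite rootE P0// ltr0n.
  rewrite (_ : uniq _); last first.
    rewrite map_inj_uniq ?iota_uniq// => k l /eqP; rewrite eqr_nat eqSS => /eqP//.
  move=> /(_ isT isT); rewrite size_map size_iota ltnNge.
  by rewrite size_poly.
have := coef_poly n.+1 (fun k => ball_const k * (V (n - k)%N - W (n - k)%N)) (n - j).
rewrite -/P P0 coef0 ltnS leq_subr subKn// => /esym/eqP.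
by rewrite mulf_eq0 gt_eqF ?ball_const_gt0//= subr_eq0 => /eqP.
Qed.

Definition box (n : nat) (a : nat -> R) : set 'rV[R]_n :=
  [set x | forall i : 'I_n, `|x 0 i| <= a i].

(** For [0 <= a], the point of [[-a, a]] nearest to [t]. *)
Definition clamp (a t : R) : R := Num.max (- a) (Num.min t a).

Lemma norm_clamp a t : 0 <= a -> `|clamp a t| <= a.
Proof.
move=> a0; rewrite ler_norml /clamp le_max lexx/= ge_max ge_min lexx orbT andbT.
by lra.
Qed.

Lemma sqr_sub_clamp a t : 0 <= a -> (t - clamp a t) ^+ 2 = gap a t ^+ 2.
Proof.
move=> a0; rewrite /clamp /gap.
have [ta|ta] := leP t a.
  have [ta'|ta'] := leP (- a) t.
    rewrite max_l ?subrr//; have : `|t| <= a by rewrite ler_norml ta'.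
    by lra.
  by rewrite ltr0_norm ?max_r; [ring|lra|lra].
by rewrite max_r ?gtr0_norm ?max_r//; lra.
Qed.

Lemma gap_ge0 (a t : R) : 0 <= gap a t.
Proof. by rewrite /gap le_max lexx. Qed.

Lemma gap_le (a x y : R) : `|x| <= a -> gap a (x + y) <= `|y|.
Proof.
move=> xa; rewrite /gap ge_max normr_ge0/=.
by have := ler_normD x y; lra.
Qed.

Lemma parallel_body_box n a (rho : R) : (forall i, 0 <= a i) -> 0 < rho ->
  parallel_body (@box n a) rho = @box_nbhd R n a (rho ^+ 2).
Proof.
move=> a0 r0; apply/seteqP; split => z.
  move=> [x [b [xa [b1 ->]]]]; rewrite /box_nbhd/=.
  apply: (@le_trans _ _ (rho ^+ 2 * dotv b b)); last first.
    by rewrite ler_piMr ?sqr_ge0.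
  rewrite /dotv mulr_sumr; apply: ler_sum => i _; rewrite !mxE.
  rewrite -expr2 -exprMn -[leRHS]real_normK ?num_real// lerXn2r ?nnegrE ?gap_ge0//.
  exact: gap_le.
rewrite /box_nbhd/= => hz.
(* The nearest point of a box is found coordinate by coordinate. *)
exists (\row_i clamp (a i) (z 0 i)), (rho^-1 *: (z - \row_i clamp (a i) (z 0 i))).
split; first by move=> i; rewrite mxE norm_clamp.
split; last by rewrite scalerA divff ?gt_eqF// scale1r addrC subrK.
rewrite /unit_ball/= /dotv.
have -> : (\sum_(i < n) (rho^-1 *: (z - \row_i0 clamp (a i0) (z 0 i0))) 0 i *
   (rho^-1 *: (z - \row_i0 clamp (a i0) (z 0 i0))) 0 i) =
   (rho ^+ 2)^-1 * \sum_(i < n) gap (a i) (z 0 i) ^+ 2.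
  rewrite mulr_sumr; apply: eq_bigr => i _.
  by rewrite !mxE -expr2 exprMn sqr_sub_clamp// exprVn.
by rewrite ler_pdivrMl ?exprn_gt0// mulr1.
Qed.

(** The coefficients of [box_poly] satisfy the Steiner formula, so the value chosen by [epsilon]
    satisfies it too, and uniqueness identifies the two at index [j]. The factor [2] turns
    half-widths into widths. *)
Lemma intrinsic_volume_box n a j : (forall i, 0 <= a i) -> (j <= n)%N ->
  intrinsic_volume (@box n a) j = (box_poly n (fun i => 2 * a i))`_j.
Proof.
move=> a0 jn.
have h : steiner_coeffs (@box n a) (fun j => (box_poly n (fun i => 2 * a i))`_j).
  move=> rho r0; rewrite parallel_body_box// volume_box_nbhd//; congr EFin.
  apply: eq_bigr => i _; rewrite radius_pow_sqr ?ltW// kappaE; ring.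
apply: (steiner_coeffs_unique jn _ h).
exact: (ClassicalEpsilon.epsilon_spec (inhabits _) _ (ex_intro _ _ h)).
Qed.

Lemma convex_box n a : Defs.convex_set (@box n a).
Proof.
move=> x y t xa ya /andP[t0 t1] i; rewrite !mxE.
have t1' : 0 <= 1 - t by lra.
apply: (le_trans (ler_normD _ _)); rewrite !normrM (ger0_norm t0) (ger0_norm t1').
have := xa i; have := ya i; have := normr_ge0 (x 0 i); have := normr_ge0 (y 0 i).
nra.
Qed.

Lemma origin_symmetric_box n a : origin_symmetric (@box n a).
Proof. by move=> x xa i; rewrite mxE normrN. Qed.

Lemma compact_box n a : compact (@box n a).
Proof.
rewrite (_ : @box n a = [set v : 'rV[R]_n | forall i : 'I_n, `[- a i, a i]%classic (v ord0 i)]).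
  by apply: (@rV_compact R n (fun i => `[- a i, a i]%classic)) => i; exact: segment_compact.
by apply/seteqP; split => x /= xa i; have := xa i; rewrite /= in_itv/= ler_norml.
Qed.

Lemma convex_body_box n a : (forall i, 0 < a i) -> convex_body (@box n a).
Proof.
move=> a0; split; first exact: convex_box.
split; first exact: compact_box.
exists 0; pose e := \big[Num.min/1]_(i < n) a i.
have e0 : 0 < e.
  by rewrite /e; elim/big_ind : _ => // x y x0 y0; rewrite lt_min x0.
apply/nbhs_ballP; exists e => //= x xe i.
have [_ /(_ 0 i)] := xe; rewrite /ball/= mxE sub0r normrN => /ltW/le_trans; apply.
by rewrite /e (bigD1 i)//= ge_min lexx.
Qed.

Lemma support_fun_box n a u : (forall i, 0 <= a i) ->
  support_fun (@box n a) u = \sum_(i < n) a i * `|u 0 i|.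
Proof.
move=> a0; rewrite /support_fun.
have hub : ubound [set dotv u y | y in @box n a] (\sum_(i < n) a i * `|u 0 i|).
  move=> _ [y ya <-]; apply: ler_sum => i _.
  by apply: (le_trans (ler_norm _)); rewrite normrM mulrC ler_wpM2r.
have hin : [set dotv u y | y in @box n a] (\sum_(i < n) a i * `|u 0 i|).
  (* The maximum is attained at the point of the box whose signs agree with those of [u]. *)
  exists (\row_i (a i * Num.sg (u 0 i))).
    move=> i; rewrite mxE normrM ger0_norm// ler_piMr//.
    by rewrite normr_sg; case: (_ == 0).
  by apply: eq_bigr => i _; rewrite mxE mulrCA normrEsg [u 0 i * _]mulrC.
apply/eqP; rewrite eq_le; apply/andP; split.
  by apply: ge_sup => //; eexists; exact: hin.
by apply: ub_le_sup => //; eexists; exact: hub.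
Qed.

End BoxBodies.

(** * Two-variable power means: homogeneity, monotonicity, superadditivity *)

Section LpMeans.
Context {R : realType}.
Implicit Types (p lam x y : R).

(** Young's inequality for the conjugate exponents [1 / (1 - lam)] and [1 / lam]. *)
Lemma powR_amgm lam x y : 0 < lam < 1 -> 0 <= x -> 0 <= y ->
  x `^ (1 - lam) * y `^ lam <= (1 - lam) * x + lam * y.
Proof.
move=> /andP[l0 l1] x0 y0.
have l1' : 0 < 1 - lam by lra.
have := @conjugate_powR R (x `^ (1 - lam)) (y `^ lam) (1 - lam)^-1 lam^-1
  (powR_ge0 _ _) (powR_ge0 _ _).
rewrite !invr_gt0 !invrK subrK => /(_ l1' l0 erefl).
by rewrite -!powRrM !divff ?gt_eqF// !powRr1// ![_ * (1 - lam)]mulrC [_ * lam]mulrC.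
Qed.

(** The graph of the geometric mean lies below its tangent plane at [(x', y')]: apply [powR_amgm] to
    the quotients [x / x'] and [y / y']. *)
Lemma powR_amgm_scaled lam x y x' y' : 0 < lam < 1 -> 0 <= x -> 0 <= y ->
  0 < x' -> 0 < y' -> x `^ (1 - lam) * y `^ lam <=
    x' `^ (1 - lam) * y' `^ lam * ((1 - lam) * (x / x') + lam * (y / y')).
Proof.
move=> lam01 x0 y0 x'0 y'0.
have x'0' := ltW x'0; have y'0' := ltW y'0.
have u0 : 0 <= x / x' by rewrite divr_ge0.
have v0 : 0 <= y / y' by rewrite divr_ge0.
have -> : x `^ (1 - lam) = x' `^ (1 - lam) * (x / x') `^ (1 - lam).
  by rewrite -powRM// mulrC divfK ?gt_eqF.
have -> : y `^ lam = y' `^ lam * (y / y') `^ lam.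
  by rewrite -powRM// mulrC divfK ?gt_eqF.
by rewrite mulrACA ler_wpM2l ?mulr_ge0 ?powR_ge0// powR_amgm.
Qed.

Lemma powR_concave p t x y : 0 < p < 1 -> 0 < t < 1 -> 0 <= x -> 0 <= y ->
  t * x `^ p + (1 - t) * y `^ p <= (t * x + (1 - t) * y) `^ p.
Proof.
move=> /andP[p0 p1] /andP[t0 t1] x0 y0.
have [m mE] : exists z, z = t * x + (1 - t) * y := ex_intro _ _ erefl.
rewrite -mE.
have t1' : 0 < 1 - t by lra.
have m0 : 0 <= m by rewrite mE addr_ge0// mulr_ge0// ltW.
have [m00|mn0] := eqVneq m 0.
  move: (m00) => /eqP; rewrite mE paddr_eq0 ?mulr_ge0 ?(ltW t0) ?(ltW t1')// !mulf_eq0 (gt_eqF t0) (gt_eqF t1')/=.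
  by move=> /andP[/eqP -> /eqP ->]; rewrite powR0 ?gt_eqF// !mulr0 addr0 powR_ge0.
have mp : 0 < m by rewrite lt_neqAle eq_sym mn0.
(* The tangent line at the mean [m], obtained from [powR_amgm] for [z / m] and [1]. Averaging it
   over [x] and [y] gives concavity. *)
have tangent z : 0 <= z -> z `^ p <= m `^ p * (p * (z / m) + (1 - p)).
  move=> z0; rewrite -{1}(divfK mn0 z) powRM ?divr_ge0// mulrC.
  rewrite ler_wpM2l ?powR_ge0//.
  have := @powR_amgm (1 - p) (z / m) 1; rewrite powR1 subKr !mulr1; apply => //.
    by apply/andP; split; lra.
  by rewrite divr_ge0.
apply: (@le_trans _ _ (t * (m `^ p * (p * (x / m) + (1 - p))) +
  (1 - t) * (m `^ p * (p * (y / m) + (1 - p))))).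
  by rewrite lerD// ler_wpM2l ?tangent// ltW.
have -> : t * (m `^ p * (p * (x / m) + (1 - p))) +
  (1 - t) * (m `^ p * (p * (y / m) + (1 - p))) =
  m `^ p * (p * ((t * x + (1 - t) * y) / m) + (1 - p)) by field.
by rewrite -mE divff// mulr1 addrC subrK mulr1.
Qed.

Lemma powR_lt_self x p : 0 < x < 1 -> 1 < p -> x `^ p < x.
Proof.
move=> /andP[x0 x1] p1.
rewrite -mulr_powRB1 ?ltW//; last lra.
rewrite gtr_pMr// -[ltRHS](congr1 (@^~ (p - 1)) (@powR1 R)).
by apply: gt0_ltr_powR; rewrite ?nnegrE ?subr_gt0 ?ltW.
Qed.

Definition Lp_mean p lam x y : R :=
  if p == 0 then x `^ (1 - lam) * y `^ lam
  else ((1 - lam) * x `^ p + lam * y `^ p) `^ p^-1.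

Lemma Lp_mean0E lam x y : Lp_mean 0 lam x y = x `^ (1 - lam) * y `^ lam.
Proof. by rewrite /Lp_mean eqxx. Qed.

Lemma Lp_meanE p lam x y : p != 0 ->
  Lp_mean p lam x y = ((1 - lam) * x `^ p + lam * y `^ p) `^ p^-1.
Proof. by move=> /negbTE p0; rewrite /Lp_mean p0. Qed.

Lemma Lp_mean_ge0 p lam x y : 0 <= Lp_mean p lam x y.
Proof. by rewrite /Lp_mean; case: ifP => _; rewrite ?powR_ge0// mulr_ge0 ?powR_ge0. Qed.

Section FixedWeight.
Variables p lam : R.
Hypothesis p01 : 0 <= p < 1.
Hypothesis lam01 : 0 < lam < 1.

Lemma weight_gt0 : [/\ 0 < lam, 0 < 1 - lam & p != 0 -> 0 < p].
Proof.
move: p01 lam01 => /andP[p0 _] /andP[l0 l1]; split; [by []|lra|].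
by move=> pn0; rewrite lt_neqAle eq_sym pn0.
Qed.

Lemma Lp_mean_scale c x y : 0 <= c -> 0 <= x -> 0 <= y ->
  Lp_mean p lam (c * x) (c * y) = c * Lp_mean p lam x y.
Proof.
have [lam0 lam1 p0] := weight_gt0.
move=> c0 x0 y0; have [->|pn0] := eqVneq p 0.
  rewrite !Lp_mean0E !powRM// mulrACA -powRD ?subrK ?powRr1//.
  by rewrite oner_eq0.
have pp := p0 pn0; rewrite !Lp_meanE// !powRM// (mulrCA (1 - lam)) (mulrCA lam) -mulrDr powRM ?powR_ge0//.
  by rewrite -powRrM divff ?gt_eqF// powRr1.
by rewrite addr_ge0// mulr_ge0 ?powR_ge0// ltW.
Qed.

Lemma Lp_mean_id x : 0 <= x -> Lp_mean p lam x x = x.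
Proof.
move=> x0; rewrite -{1 2}(mulr1 x) Lp_mean_scale//.
have [->|pn0] := eqVneq p 0; first by rewrite Lp_mean0E !powR1 !mulr1.
by rewrite Lp_meanE// !powR1 !mulr1 subrK powR1 mulr1.
Qed.

Lemma Lp_mean_le x y x' y' : 0 <= x -> 0 <= y -> x <= x' -> y <= y' ->
  Lp_mean p lam x y <= Lp_mean p lam x' y'.
Proof.
have [lam0 lam1 p0] := weight_gt0.
move=> x0 y0 xx' yy'.
have x'0 := le_trans x0 xx'; have y'0 := le_trans y0 yy'.
have [->|pn0] := eqVneq p 0.
  by rewrite !Lp_mean0E ler_pM ?powR_ge0// ge0_ler_powR ?nnegrE// ltW.
have pp := p0 pn0.
have h z z' : 0 <= z -> z <= z' -> z `^ p <= z' `^ p.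
  by move=> z0 zz'; rewrite ge0_ler_powR ?nnegrE ?(le_trans z0 zz')// ltW.
rewrite !(@Lp_meanE p _ _ _ pn0); apply: ge0_ler_powR.
- by rewrite invr_ge0 ltW.
- by rewrite nnegrE addr_ge0 ?mulr_ge0 ?powR_ge0 ?(ltW lam1) ?(ltW lam0).
- by rewrite nnegrE addr_ge0 ?mulr_ge0 ?powR_ge0 ?(ltW lam1) ?(ltW lam0).
- by rewrite lerD ?ler_wpM2l ?h ?(ltW lam1) ?(ltW lam0).
Qed.

(** A reverse Minkowski inequality. For [p = 0], two tangent-plane bounds at the sum vector are
    added. For [p > 0], both vectors are normalised to mean [1], and the concavity of the [p]-th
    power of the mean is combined with homogeneity. *)
Lemma Lp_mean_superadd x y x' y' : 0 <= x -> 0 <= y -> 0 <= x' -> 0 <= y' ->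
  Lp_mean p lam x y + Lp_mean p lam x' y' <= Lp_mean p lam (x + x') (y + y').
Proof.
have [lam0 lam1 p0] := weight_gt0.
move=> x0 y0 x'0 y'0.
have [A AE] : exists z, z = Lp_mean p lam x y := ex_intro _ _ erefl.
have [B BE] : exists z, z = Lp_mean p lam x' y' := ex_intro _ _ erefl.
rewrite -AE -BE.
(* If one mean vanishes, monotonicity suffices; afterwards [A] and [B] may be divided by. *)
have [A0|An0] := eqVneq A 0; first by rewrite A0 add0r BE Lp_mean_le// lerDr.
have [B0|Bn0] := eqVneq B 0; first by rewrite B0 addr0 AE Lp_mean_le// lerDl.
have Ap : 0 < A by rewrite lt_neqAle eq_sym An0 AE Lp_mean_ge0.
have Bp : 0 < B by rewrite lt_neqAle eq_sym Bn0 BE Lp_mean_ge0.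
have ABp : 0 < A + B by rewrite addr_gt0.
have ABn0 : A + B != 0 by rewrite gt_eqF.
have [pe0|pn0] := eqVneq p 0.
  have xyp (z w : R) : 0 <= z -> 0 <= w -> Lp_mean p lam z w != 0 -> 0 < z /\ 0 < w.
    move=> z0 w0; rewrite pe0 Lp_mean0E mulf_eq0 !powR_eq0 !(gt_eqF lam0) !(gt_eqF lam1).
    by rewrite !andbT negb_or !lt_neqAle z0 w0 !andbT ![0 == _]eq_sym => /andP.
  rewrite AE in An0 *; rewrite BE in Bn0 *.
  have [xp yp] := xyp _ _ x0 y0 An0; have [x'p y'p] := xyp _ _ x'0 y'0 Bn0.
  have Xp : 0 < x + x' by rewrite addr_gt0.
  have Yp : 0 < y + y' by rewrite addr_gt0.
  have [M ME] : exists z, z = Lp_mean p lam (x + x') (y + y') := ex_intro _ _ erefl.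
  have bound (z w : R) : 0 < z -> 0 < w ->
      Lp_mean p lam z w <= M * ((1 - lam) * (z / (x + x')) + lam * (w / (y + y'))).
    move=> z0 w0; rewrite ME pe0 !Lp_mean0E.
    by apply: powR_amgm_scaled => //; exact: ltW.
  apply: (le_trans (lerD (bound _ _ xp yp) (bound _ _ x'p y'p))).
  rewrite -mulrDr -ME.
  have -> : (1 - lam) * (x / (x + x')) + lam * (y / (y + y')) +
    ((1 - lam) * (x' / (x + x')) + lam * (y' / (y + y'))) = 1.
    by field; rewrite !gt_eqF.
  by rewrite mulr1.
have pp := p0 pn0; have /andP[_ p1] := p01.
pose g (z w : R) := (1 - lam) * z `^ p + lam * w `^ p.
have g0 z w : 0 <= g z w by rewrite addr_ge0// mulr_ge0 ?powR_ge0// ltW.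
have gE z w : g z w = Lp_mean p lam z w `^ p.
  by rewrite (@Lp_meanE p _ _ _ pn0) -powRrM mulVf// powRr1//; exact: g0.
have gA : g (A^-1 * x) (A^-1 * y) = 1.
  by rewrite gE Lp_mean_scale ?invr_ge0 ?(ltW Ap)// -AE mulVf// powR1.
have gB : g (B^-1 * x') (B^-1 * y') = 1.
  by rewrite gE Lp_mean_scale ?invr_ge0 ?(ltW Bp)// -BE mulVf// powR1.
pose t := A / (A + B).
have t01 : 0 < t < 1.
  by rewrite divr_gt0//= ltr_pdivrMr// mul1r ltrDl.
(* The rescaled sum is the convex combination, with weight [t], of the two normalised vectors. *)
have gAB : 1 <= g ((A + B)^-1 * (x + x')) ((A + B)^-1 * (y + y')).
  have conv (z z' : R) : (A + B)^-1 * (z + z') = t * (A^-1 * z) + (1 - t) * (B^-1 * z').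
    by rewrite /t; field; rewrite An0 Bn0 ABn0.
  rewrite !conv.
  have e1 : 1 = t * g (A^-1 * x) (A^-1 * y) + (1 - t) * g (B^-1 * x') (B^-1 * y').
    by rewrite gA gB !mulr1 addrC subrK.
  rewrite [leLHS]e1; have p01' : 0 < p < 1 by rewrite pp.
  have wsum (u u' v v' : R) : t * ((1 - lam) * u + lam * v) +
      (1 - t) * ((1 - lam) * u' + lam * v') =
      (1 - lam) * (t * u + (1 - t) * u') + lam * (t * v + (1 - t) * v') by ring.
  rewrite /g wsum; apply: lerD; apply: ler_wpM2l; rewrite ?(ltW lam0) ?(ltW lam1)//;
    by apply: powR_concave; rewrite ?mulr_ge0 ?invr_ge0 ?(ltW Ap) ?(ltW Bp).
move: gAB; rewrite gE Lp_mean_scale ?invr_ge0 ?(ltW ABp)// ?addr_ge0//.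
move=> gAB'; suff : 1 <= (A + B)^-1 * Lp_mean p lam (x + x') (y + y').
  by rewrite ler_pdivlMl// mulr1.
(* The exponent [p] is removed by contraposition: a nonnegative number below [1] has its [p]-th
   power below [1]. *)
rewrite leNgt; apply/negP => lt1; move: gAB'; rewrite leNgt => /negP; apply.
rewrite -[ltRHS](congr1 (@^~ p) (@powR1 R)).
apply: gt0_ltr_powR; rewrite ?nnegrE//.
by rewrite mulr_ge0 ?Lp_mean_ge0// invr_ge0 ltW.
Qed.

End FixedWeight.
End LpMeans.

(** * Combinations of boxes, and the strict inequality between means *)

Section LpCombinationOfBoxes.
Context {R : realType}.
Variables p lam : R.
Hypothesis p01 : 0 <= p < 1.
Hypothesis lam01 : 0 < lam < 1.

(** The geometric mean is the [q]-th root of the geometric mean of the [q]-th powers, to which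
    [powR_amgm] applies. *)
Lemma geometric_le_power_mean q x y : 0 < q -> 0 <= x -> 0 <= y ->
  x `^ (1 - lam) * y `^ lam <= ((1 - lam) * x `^ q + lam * y `^ q) `^ q^-1.
Proof.
move=> q0 x0 y0; have /andP[lam0 lam1'] := lam01.
have lam1 : 0 < 1 - lam by lra.
have geoE : x `^ (1 - lam) * y `^ lam =
    ((x `^ q) `^ (1 - lam) * (y `^ q) `^ lam) `^ q^-1.
  have e z w : ((z `^ q) `^ w) `^ q^-1 = z `^ w :> R.
    by rewrite -!powRrM; congr (_ `^ _); field; rewrite gt_eqF.
  exact: (etrans (congr2 *%R (esym (e x _)) (esym (e y _)))
    (esym (powRM _ (powR_ge0 _ _) (powR_ge0 _ _)))).
rewrite [leLHS]geoE; apply: ge0_ler_powR.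
- by rewrite invr_ge0 ltW.
- by rewrite nnegrE mulr_ge0 ?powR_ge0.
- by rewrite nnegrE addr_ge0 ?mulr_ge0 ?powR_ge0 ?(ltW lam1) ?(ltW lam0).
- by apply: powR_amgm; rewrite ?powR_ge0.
Qed.

(** As [r] tends to [0], the sum tends to [0] if [p = 0], and otherwise to the sum of the powers of
    [1 - lam] and [lam] with exponent [1 / p > 1], which is below [1]. *)
Lemma Lp_mean_transversal_lt1 :
  exists2 r, 0 < r & Lp_mean p lam 1 r + Lp_mean p lam r 1 < 1.
Proof.
have [lam0 lam1 p0] := weight_gt0 p01 lam01.
have [->|pn0] := eqVneq p 0.
  have half01 : (0 : R) < (2 : R)^-1 < 1.
    by apply/andP; split; lra.
  (* This exponent turns the two means into powers of [1/2] with exponents [1 / (1 - lam)] and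
     [1 / lam], both above [1]. *)
  exists (2^-1 `^ (lam^-1 * (1 - lam)^-1)); first by rewrite powR_gt0; lra.
  rewrite !Lp_mean0E !powR1 mul1r mulr1 -!powRrM.
  have -> : lam^-1 * (1 - lam)^-1 * lam = (1 - lam)^-1 by field; rewrite !gt_eqF.
  have -> : lam^-1 * (1 - lam)^-1 * (1 - lam) = lam^-1 by field; rewrite !gt_eqF.
  have h1 : 2^-1 `^ (1 - lam)^-1 < 2^-1 :> R.
    by apply: powR_lt_self => //; rewrite invf_gt1//; lra.
  have h2 : 2^-1 `^ lam^-1 < 2^-1 :> R.
    by apply: powR_lt_self => //; rewrite invf_gt1//; lra.
  by lra.
have pp := p0 pn0; have /andP[_ p1] := p01.
have lt_root (z : R) : 0 < z < 1 -> z < z `^ p.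
  move=> /andP[z0 z1].
  have zp0 : 0 < z `^ p by rewrite powR_gt0.
  have zp1 : z `^ p < 1.
    rewrite -[ltRHS](congr1 (@^~ p) (@powR1 R)).
    by apply: gt0_ltr_powR; rewrite ?nnegrE ?ler01// ltW.
  rewrite -{1}(powRr1 (ltW z0)) -{1}(mulfV pn0) powRrM.
  by apply: powR_lt_self; rewrite ?zp0// invf_gt1.
have lam1lt : 1 - lam < (1 - lam) `^ p by apply: lt_root; apply/andP; split; lra.
have lam0lt : lam < lam `^ p by apply: lt_root; apply/andP; split; lra.
(* [q] will be the [p]-th power of [r]. Being at most both gaps, it keeps [1 - lam + lam * q] and
   [(1 - lam) * q + lam] below the [p]-th powers of [1 - lam] and [lam]. *)
pose q := Num.min ((1 - lam) `^ p - (1 - lam)) (lam `^ p - lam).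
have q0 : 0 < q by rewrite lt_min !subr_gt0 lam1lt.
have q1 : q <= (1 - lam) `^ p - (1 - lam) by rewrite ge_min lexx.
have q2 : q <= lam `^ p - lam by rewrite ge_min lexx orbT.
exists (q `^ p^-1); first exact: powR_gt0.
rewrite !(@Lp_meanE _ p _ _ _ pn0) -powRrM mulVf// powRr1 ?(ltW q0)// !powR1 !mulr1.
have root_lt (z w : R) : 0 <= w -> 0 <= z -> w < z `^ p -> w `^ p^-1 < z.
  move=> w0 z0 wz; rewrite -[ltRHS](powRr1 z0) -(mulfV pn0) powRrM.
  by apply: gt0_ltr_powR; rewrite ?invr_gt0 ?nnegrE ?powR_ge0.
have h1 : (1 - lam + lam * q) `^ p^-1 < 1 - lam.
  by apply: root_lt; [|exact: ltW|]; nra.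
have h2 : ((1 - lam) * q + lam) `^ p^-1 < lam.
  by apply: root_lt; [|exact: ltW|]; nra.
by lra.
Qed.

Lemma Lp_mean_sum_le n (f g : 'I_n -> R) :
  (forall i, 0 <= f i) -> (forall i, 0 <= g i) ->
  \sum_i Lp_mean p lam (f i) (g i) <= Lp_mean p lam (\sum_i f i) (\sum_i g i).
Proof.
move=> f0 g0.
suff [] : [/\ \sum_i Lp_mean p lam (f i) (g i) <=
    Lp_mean p lam (\sum_i f i) (\sum_i g i), 0 <= \sum_i f i & 0 <= \sum_i g i] by [].
apply: (big_rec3 (fun s x y => [/\ s <= Lp_mean p lam x y, 0 <= x & 0 <= y])).
  by split => //; exact: Lp_mean_ge0.
move=> i y x s _ [le_s x0 y0]; split; [|by rewrite addr_ge0..].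
by apply: le_trans (Lp_mean_superadd p01 lam01 (f0 i) (g0 i) x0 y0); rewrite lerD2l.
Qed.

Lemma Lp_comb_wulff n (K L : set 'rV[R]_n) :
  Lp_comb p lam K L =
  wulff (fun u => Lp_mean p lam (support_fun K u) (support_fun L u)).
Proof.
rewrite /Lp_comb; have [->|pn0] := eqVneq p 0.
  by congr wulff; apply/funext => u; rewrite Lp_mean0E.
by congr wulff; apply/funext => u; rewrite Lp_meanE.
Qed.

(** One inclusion tests the Wulff condition at the unit vectors of both signs on each axis, where
    the support functions are single half-widths. The other is superadditivity, summed over the
    coordinates of [u]. *)
Lemma Lp_comb_box n a b : (forall i, 0 <= a i) -> (forall i, 0 <= b i) ->
  Lp_comb p lam (@box R n a) (@box R n b) =
  @box R n (fun i => Lp_mean p lam (a i) (b i)).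
Proof.
move=> a0 b0; rewrite Lp_comb_wulff; apply/seteqP; split => x.
  move=> xW i.
  have axis (s : R) : `|s| = 1 -> x 0 i * s <= Lp_mean p lam (a i) (b i).
    move=> s1; pose u : 'rV[R]_n := s *: delta_mx 0 i.
    have uE k : u 0 k = if k == i then s else 0.
      by rewrite !mxE eqxx/=; case: eqP; rewrite ?mulr1 ?mulr0.
    have supp w : (forall i, 0 <= w i) -> support_fun (@box R n w) u = w i.
      move=> w0; rewrite support_fun_box// (bigD1 i)//= uE eqxx s1 mulr1.
      by rewrite big1 ?addr0// => k /negbTE ki; rewrite uE ki normr0 mulr0.
    have := xW u; rewrite !supp//; have -> : dotv x u = x 0 i * s.
      rewrite /dotv (bigD1 i)//= uE eqxx big1 ?addr0// => k /negbTE ki.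
      by rewrite uE ki mulr0.
    apply; rewrite /unit_sphere/= /dotv (bigD1 i)//= uE eqxx big1 ?addr0.
      by rewrite -expr2 -real_normK ?num_real// s1 expr1n.
    by move=> k /negbTE ki; rewrite uE ki mulr0.
  have := axis 1 (normr1 _); have := axis (-1) (normrN1 _).
  rewrite mulrN1 mulr1 => h1 h2; rewrite ler_norml h2 andbT.
  by rewrite lerNl.
move=> xb u _; rewrite !support_fun_box//.
apply: le_trans (Lp_mean_sum_le _ _) => [|i|i]; [|by rewrite mulr_ge0..].
apply: ler_sum => i _; rewrite ![_ * `|u 0 i|]mulrC Lp_mean_scale//.
by apply: (le_trans (ler_norm _)); rewrite normrM mulrC ler_wpM2l.
Qed.

End LpCombinationOfBoxes.

(** * Estimates for elementary symmetric functions of unit and small widths *)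

Section BoxCoefficients.
Context {R : realType}.
Implicit Types (w : nat -> R).

Fixpoint ones (k : nat) w : nat -> R :=
  if k is k'.+1 then fun i => if i is i'.+1 then ones k' w i' else 1 else w.

Lemma coef_box_poly0 n w : (box_poly n w)`_0 = 1.
Proof.
elim: n w => [|n IHn] w; first by rewrite /box_poly big_ord0 coef1.
by rewrite coef_box_polyS IHn addr0.
Qed.

Lemma coef_box_poly1 n w : (box_poly n w)`_1 = \sum_(i < n) w i.
Proof.
elim: n w => [|n IHn] w; first by rewrite /box_poly !big_ord0 coef1.
by rewrite coef_box_polyS IHn coef_box_poly0 mulr1 addrC big_ord_recl.
Qed.

(** Each further width at most doubles the bounds, since it adds [w 0] times the preceding
    coefficient. *)
Lemma coef_box_poly_le n w (d : R) : (forall i, 0 <= w i <= d) -> d <= 1 ->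
  (forall i, (box_poly n w)`_i.+1 <= 2 ^+ n * d) /\
  (forall i, (box_poly n w)`_i.+2 <= 2 ^+ n * d ^+ 2).
Proof.
move=> + d1; elim: n w => [|n IHn] w wd.
  have d0 : 0 <= d by have /andP[] := wd 0%N; exact: le_trans.
  by split => i; rewrite /box_poly big_ord0 coef1/= expr0 mul1r ?exprn_ge0.
have /andP[w0 w0d] := wd 0%N; have d0 := le_trans w0 w0d.
have [IH1 IH2] := IHn (fun i => w i.+1) (fun i => wd i.+1).
have c0 j : 0 <= (box_poly n (fun i => w i.+1))`_j.
  by apply: coef_box_poly_ge0 => i; have /andP[] := wd i.+1.
have p1 : 1 <= 2 ^+ n :> R by rewrite exprn_ege1// ler1n.
split => i; rewrite coef_box_polyS exprS -mulrA mulr_natl mulr2n lerD//.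
- case: i => [|i].
    by rewrite coef_box_poly0 mulr1 (le_trans w0d)// ler_peMl.
  by rewrite mulrC ler_pM// (le_trans (IH1 i))// ler_piMr// exprn_ge0.
- by rewrite expr2 mulrCA ler_pM.
Qed.

(** Prepending a width [1] adds neighbouring coefficients, so [sigma] enters once while the higher
    terms at most double. The second bound carries the induction. *)
Lemma coef_box_poly_ones_le n k w (sigma tau : R) : 0 <= tau ->
  (box_poly n w)`_1 <= sigma -> (forall i, (box_poly n w)`_i.+2 <= tau) ->
  (box_poly (k + n) (ones k w))`_k.+1 <= sigma + 2 ^+ k * tau /\
  (forall i, (box_poly (k + n) (ones k w))`_(k + i).+2 <= 2 ^+ k * tau).
Proof.
move=> t0 hs ht; elim: k => [|k [IH1 IH2]].
  by split => [|i]; rewrite /= ?add0n ?expr0 ?mul1r ?(le_trans hs)// lerDl.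
split => [|i]; rewrite addSn coef_box_polyS /= mul1r exprS -mulrA mulr_natl mulr2n.
  by rewrite addrCA lerD//; have := IH2 0%N; rewrite addn0.
by apply: lerD; [have := IH2 i.+1; rewrite addnS | exact: IH2].
Qed.

(** The sum on the left comes from the subsets made of all [k] ones and a single entry of [w]; the
    other subsets contribute nonnegative terms. *)
Lemma coef_box_poly_ones_ge n k w : (forall i, 0 <= w i) ->
  \sum_(i < n) w i <= (box_poly (k + n) (ones k w))`_k.+1.
Proof.
move=> w0; have ones0 m i : 0 <= ones m w i.
  by elim: m i => [|m IHm] [|i] //=.
elim: k => [|k IHk]; first by rewrite coef_box_poly1.
rewrite addSn coef_box_polyS /= mul1r (le_trans IHk)// lerDr.
exact: coef_box_poly_ge0.
Qed.

Lemma ones_gt0 k w : (forall i, 0 < w i) -> forall i, 0 < ones k w i.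
Proof. by move=> w0; elim: k => [//|k IHk] [|i] //=. Qed.

Lemma map_ones k w w' (f : R -> R -> R) i : f 1 1 = 1 ->
  f (ones k w i) (ones k w' i) = ones k (fun i => f (w i) (w' i)) i.
Proof. by move=> f1; elim: k i => [//|k IHk] [|i] //=. Qed.

Definition tail3 (al be ga : R) (i : nat) : R :=
  match i with 0 => al | 1 => be | _ => ga end.

Lemma tail3_gt0 al be ga i : 0 < al -> 0 < be -> 0 < ga -> 0 < tail3 al be ga i.
Proof. by case: i => [|[|i]]. Qed.

Lemma map_tail3 al be ga al' be' ga' (f : R -> R -> R) i :
  f (tail3 al be ga i) (tail3 al' be' ga' i) =
  tail3 (f al al') (f be be') (f ga ga') i.
Proof. by case: i => [|[|i]]. Qed.

Lemma sum_tail3 m al be ga :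
  \sum_(i < m.+2) tail3 al be ga i = al + be + m%:R * ga.
Proof.
by rewrite !big_ord_recl/= sumr_const card_ord addrA mulr_natl.
Qed.

(* The [k + 1]-subsets meeting the [m + 2] small widths only once contribute
   [d (A + B) + m d^2]; all others are of order [d^2]. *)
Lemma coef_box_poly_small k m (A B : R) : 0 <= A -> 0 <= B -> A + B < 1 ->
  exists2 d : R, 0 < d &
    (box_poly (k + m.+2) (ones k (tail3 (d * A) (d * B) (d ^+ 2))))`_k.+1 < d.
Proof.
move=> A0 B0 AB1.
have [N NE] : exists N : R, N = m%:R + 2 ^+ k * 2 ^+ m.+2 := ex_intro _ _ erefl.
have N0 : 0 <= N by rewrite NE addr_ge0// mulr_ge0// exprn_ge0.
have N1 : 0 < 1 + N by lra.
(* [N] collects the constants of all terms in [d ^+ 2]; this [d] solves [A + B + N * d = 1 - d]. *)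
have [d dE] : exists d, d = (1 - (A + B)) / (1 + N) := ex_intro _ _ erefl.
have d0 : 0 < d by rewrite dE divr_gt0// subr_gt0.
have dN : d * (1 + N) = 1 - (A + B) by rewrite dE divfK// gt_eqF.
have d1 : d <= 1 by nra.
exists d => //.
have td i : 0 <= tail3 (d * A) (d * B) (d ^+ 2) i <= d.
  by case: i => [|[|i]] /=; apply/andP; split; nra.
have [_ h2] := coef_box_poly_le m.+2 td d1.
have t0 : 0 <= 2 ^+ m.+2 * d ^+ 2 by rewrite mulr_ge0// exprn_ge0// ltW.
have [+ _] := coef_box_poly_ones_le k t0 (lexx _) h2.
move=> /le_lt_trans; apply; rewrite coef_box_poly1 sum_tail3.
have -> : d * A + d * B + m%:R * d ^+ 2 + 2 ^+ k * (2 ^+ m.+2 * d ^+ 2) =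
  d * (A + B + N * d) by rewrite NE; ring.
by rewrite gtr_pMr//; nra.
Qed.

End BoxCoefficients.

(** * Choice of the widths and conclusion *)

Lemma exists_widths (R : realType) (p lam : R) (k m : nat) :
  0 <= p < 1 -> 0 < lam < 1 ->
  exists (wK wL : nat -> R) (d : R),
    [/\ forall i, 0 < wK i, forall i, 0 < wL i, 0 < d &
      [/\ d <= (box_poly (k + m.+2) wK)`_k.+1, d <= (box_poly (k + m.+2) wL)`_k.+1 &
       (box_poly (k + m.+2) (fun i => Lp_mean p lam (wK i) (wL i)))`_k.+1 < d]].
Proof.
move=> p01 lam01.
have [r r0 rlt] := Lp_mean_transversal_lt1 p01 lam01.
have [d d0 dlt] := coef_box_poly_small k m (Lp_mean_ge0 p lam 1 r)
  (Lp_mean_ge0 p lam r 1) rlt.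
have dr0 : 0 < d * r by rewrite mulr_gt0.
have dd0 : 0 < d ^+ 2 by rewrite exprn_gt0.
have md0 : 0 <= m%:R * d ^+ 2 by rewrite mulr_ge0// ltW.
have tK i : 0 < tail3 d (d * r) (d ^+ 2) i by exact: tail3_gt0.
have tL i : 0 < tail3 (d * r) d (d ^+ 2) i by exact: tail3_gt0.
exists (ones k (tail3 d (d * r) (d ^+ 2))), (ones k (tail3 (d * r) d (d ^+ 2))), d.
split; [exact: ones_gt0|exact: ones_gt0|by []|split].
- apply: le_trans (coef_box_poly_ones_ge _ _ _) => [|i]; last exact: ltW.
  by rewrite sum_tail3 -addrA lerDl addr_ge0// ltW.
- apply: le_trans (coef_box_poly_ones_ge _ _ _) => [|i]; last exact: ltW.
  by rewrite sum_tail3 -addrA addrCA lerDl addr_ge0// ltW.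
(* The mean fixes the widths [1] and [d ^+ 2], which both bodies share, and homogeneity extracts [d]
   from the two exchanged widths. *)
- suff -> : (fun i => Lp_mean p lam (ones k (tail3 d (d * r) (d ^+ 2)) i)
      (ones k (tail3 (d * r) d (d ^+ 2)) i)) =
    ones k (tail3 (d * Lp_mean p lam 1 r) (d * Lp_mean p lam r 1) (d ^+ 2)).
    exact: dlt.
  apply/funext => i.
  rewrite map_ones; last exact: (Lp_mean_id p01 lam01 ler01).
  congr ones; apply/funext => l; rewrite map_tail3 (Lp_mean_id p01 lam01 (ltW dd0)).
  have := Lp_mean_scale p01 lam01 (ltW d0) ler01 (ltW r0); rewrite mulr1 => ->.
  by have := Lp_mean_scale p01 lam01 (ltW d0) (ltW r0) ler01; rewrite mulr1 => ->.
Qed.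

Unset Implicit Arguments.

Theorem theorem1p1 (R : realType) (n j : nat) (p lam : R) :
  (3 <= n)%N -> (2 <= j <= n.-1)%N -> 0 <= p < 1 -> 0 < lam < 1 ->
  exists K L : set 'rV[R]_n,
    [/\ convex_body K, convex_body L, origin_symmetric K, origin_symmetric L &
       (
        intrinsic_volume (Lp_comb p lam K L) j
          < intrinsic_volume K j `^ (1 - lam) * intrinsic_volume L j `^ lam
      /\ intrinsic_volume K j `^ (1 - lam) * intrinsic_volume L j `^ lam
          <= (if p == 0 then
                intrinsic_volume K j `^ (1 - lam) * intrinsic_volume L j `^ lam
              else
                ((1 - lam) * intrinsic_volume K j `^ (p / j%:R)
                 + lam * intrinsic_volume L j `^ (p / j%:R)) `^ (j%:R / p)))].
Proof.
move=> _ /andP[j2 jn] p01 lam01.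
have [lam0 lam1 p0] := weight_gt0 p01 lam01.
case: j j2 jn => // k _ jn.
(* With [j = k + 1], the hypothesis [j <= n - 1] leaves room for the two exchanged widths after the
   [k] ones. *)
have [m nE] : exists m, n = (k + m.+2)%N.
  by exists (n - k.+2)%N; lia.
have jn' : (k.+1 <= n)%N by lia.
have [wK [wL [d [wK0 wL0 d0 [dK dL dM]]]]] := exists_widths k m p01 lam01.
rewrite -nE in dK dL dM.
have wK2 i : 0 < wK i / 2 by rewrite divr_gt0.
have wL2 i : 0 < wL i / 2 by rewrite divr_gt0.
have dblE (w : nat -> R) : (fun i => 2 * (w i / 2)) = w.
  by apply/funext => i; rewrite mulrCA divff ?mulr1 ?pnatr_eq0.
have VK : intrinsic_volume (@box R n (fun i => wK i / 2)) k.+1 = (box_poly n wK)`_k.+1.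
  by rewrite intrinsic_volume_box// ?dblE// => i; exact: ltW.
have VL : intrinsic_volume (@box R n (fun i => wL i / 2)) k.+1 = (box_poly n wL)`_k.+1.
  by rewrite intrinsic_volume_box// ?dblE// => i; exact: ltW.
have VM : intrinsic_volume (Lp_comb p lam (@box R n (fun i => wK i / 2))
    (@box R n (fun i => wL i / 2))) k.+1 =
    (box_poly n (fun i => Lp_mean p lam (wK i) (wL i)))`_k.+1.
  rewrite Lp_comb_box//; [|by move=> i; exact: ltW..].
  rewrite intrinsic_volume_box//; last by move=> i; exact: Lp_mean_ge0.
  congr (box_poly _ _)`__; apply/funext => i.
  rewrite -(Lp_mean_scale p01 lam01 (ler0n _ 2) (ltW (wK2 i)) (ltW (wL2 i))).
  by congr (Lp_mean _ _ _ _); field.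
exists (@box R n (fun i => wK i / 2)), (@box R n (fun i => wL i / 2)).
split; [exact: convex_body_box|exact: convex_body_box|
  exact: origin_symmetric_box|exact: origin_symmetric_box|].
rewrite VK VL VM; clear VK VL VM.
move: ((box_poly n wK)`_k.+1) ((box_poly n wL)`_k.+1) dK dL => v w dv dw.
have v0 : 0 < v by exact: lt_le_trans dv.
have w0 : 0 < w by exact: lt_le_trans dw.
split.
  apply: lt_le_trans dM _.
  (* The common lower bound [d] is its own geometric mean, so it passes to the geometric mean of [v]
     and [w]. *)
  have dE : d = d `^ (1 - lam) * d `^ lam.
    by rewrite -powRD ?subrK ?oner_eq0// powRr1// ltW.
  rewrite [leLHS]dE; apply: ler_pM; rewrite ?powR_ge0//.
  - by apply: ge0_ler_powR; rewrite ?nnegrE ?(ltW lam1) ?(ltW d0) ?(ltW v0).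
  - by apply: ge0_ler_powR; rewrite ?nnegrE ?(ltW lam0) ?(ltW d0) ?(ltW w0).
have [//|pn0] := eqVneq p 0.
have pj0 : 0 < p / k.+1%:R by rewrite divr_gt0 ?p0// ltr0n.
(* The outer exponent is the inverse of [p / j], so the right-hand side is the power mean of
   exponent [p / j]. *)
rewrite -[k.+1%:R / p]invf_div.
exact: (geometric_le_power_mean lam01 pj0 (ltW v0) (ltW w0)).
Qed.
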